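(* Let $\hat{\boldsymbol{\beta}}_\lambda=(X^TX+\lambda I_{d_0})^{-1}X^Ty$ be the ridge regression estimator with ridge parameter $\lambda$ applied to the data $(y,X)$, and let $\hat{\boldsymbol{\beta}}^{(d)}$ and $\hat{\boldsymbol{\beta}}_{(n)}$ be the estimators along sequences I and II defined in the context. Let $\hat{\boldsymbol{\beta}}^{(d)}_{d_0}$ denote the first $d_0$ elements of $\hat{\boldsymbol{\beta}}^{(d)}$ and $\hat{\boldsymbol{\beta}}^{(d)}_{-d_0}$ the remaining $d-d_0$ elements. Under sequence I, if $d^{-1}d_0\to\delta$, with $0\le\delta<1$, as $d\to\infty$, then $$\|\hat{\boldsymbol{\beta}}^{(d)}_{d_0}-\hat{\boldsymbol{\beta}}_{d-d_0}\|=O_p(d^{-1})\quad\text{and}\quad\|\hat{\boldsymbol{\beta}}^{(d)}_{-d_0}\|=O_p(d^{-1/2}),$$ where $\hat{\boldsymbol{\beta}}_{d-d_0}$ is the ridge regression estimator $\hat{\boldsymbol{\beta}}_\lambda$ with $\lambda=d-d_0$. Under sequence II, if $n^{-1}n_0\to\nu$ with $0\le\nu<1$, then $$\|\hat{\boldsymbol{\beta}}_{(n)}-\hat{\boldsymbol{\beta}}_{n-n_0}\|=O_p(n^{-1/2})\quad\text{as } n\to\infty,$$ where $\hat{\boldsymbol{\beta}}_{n-n_0}$ is the ridge regression estimator $\hat{\boldsymbol{\beta}}_\lambda$ with $\lambda=n-n_0$.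
   Context: Data model: $X$ is an $n_0\times d_0$ random matrix whose rows are independent $N_{d_0}(0,I_{d_0})$; $y=X\boldsymbol{\beta}_0+e$ with $e\sim N_{n_0}(0,\sigma^2I_{n_0})$, where $\boldsymbol{\beta}_0\in\mathbb{R}^{d_0}$ is an unknown regression parameter and $\sigma^2>0$ is an unknown variance parameter. Sequence I (adding predictors; $d$ increases with the number of observations $n=n_0$ fixed): for $d>d_0$ the training set is $(y,[X,Z])$, where $Z$ is an $n_0\times(d-d_0)$ matrix with independent $N_{d-d_0}(0,I_{d-d_0})$ rows that are independent of $X$ and $e$. For $d>\max(d_0,n_0)$ the estimator is the minimum norm OLS estimator $\hat{\boldsymbol{\beta}}^{(d)}=[X,Z]^T(XX^T+ZZ^T)^{-1}y\in\mathbb{R}^d$. Sequence II (adding noise observations; $n$ increases with the number of predictors $d=d_0$ fixed): for $n>n_0$ the training set is $([y^T,0_{n-n_0}^T]^T,[X^T,W^T]^T)$, where $W$ is an $(n-n_0)\times d_0$ matrix with independent $N_{d_0}(0,I_{d_0})$ rows that are independent of $X$ and $e$. For $n>\max(n_0,d_0)$ the estimator is the OLS estimator $\hat{\boldsymbol{\beta}}_{(n)}=(X^TX+W^TW)^{-1}X^Ty\in\mathbb{R}^{d_0}$. $\|\cdot\|$ is the Euclidean norm, and $O_p$ denotes order in probability.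
   Formalization: Under sequence I, where d_0 may grow with d, the Euclidean norm of the regression parameter beta_0 is assumed bounded in d; without this the second rate fails (e.g. n_0=1, d_0 about d/2, norm of beta_0 equal to d). *)

(* Defs.v *)
From HB Require Import structures.
From mathcomp Require Import all_boot all_order all_algebra.
From mathcomp Require Import all_classical all_reals all_analysis.

Set Implicit Arguments.
Unset Strict Implicit.
Unset Printing Implicit Defensive.

Import Order.TTheory GRing.Theory Num.Theory.
Import numFieldNormedType.Exports.

Local Open Scope classical_set_scope.
Local Open Scope ring_scope.

(* MathComp-Analysis norms matrices by the max norm; this is the Euclidean
   norm. *)
Definition l2norm (R : realType) (k : nat) (v : 'cV[R]_k) : R :=
  Num.sqrt (\sum_i v i 0 ^+ 2).

Section estimators.
Variable R : realType.

Definition ridge (n p : nat) (lambda : R) (X : 'M[R]_(n, p)) (y : 'cV[R]_n) :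
    'cV[R]_p :=
  invmx (X^T *m X + lambda%:M) *m X^T *m y.

(* Minimum norm OLS with the predictors [X, Z]. *)
Definition min_norm_ols_aug (n p q : nat) (X : 'M[R]_(n, p))
    (Z : 'M[R]_(n, q)) (y : 'cV[R]_n) : 'cV[R]_(p + q) :=
  (row_mx X Z)^T *m invmx (X *m X^T + Z *m Z^T) *m y.

(* OLS after adding the observations (0, W). *)
Definition ols_aug (n m p : nat) (X : 'M[R]_(n, p)) (W : 'M[R]_(m, p))
    (y : 'cV[R]_n) : 'cV[R]_p :=
  invmx (X^T *m X + W^T *m W) *m X^T *m y.

End estimators.

Section random_matrices.
Context {d : measure_display} {T : measurableType d} {R : realType}.
Variable P : probability T R.

(* A random matrix is a matrix of random variables; this is its value at w. *)
Definition eval_mx (m n : nat) (X : 'M[{RV P >-> R}]_(m, n)) (w : T) :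
    'M[R]_(m, n) :=
  map_mx (fun U : {RV P >-> R} => U w) X.

Definition sigma_mx (m n : nat) (X : 'M[{RV P >-> R}]_(m, n)) :
    set (set T) :=
  <<s \bigcup_(ij : 'I_m * 'I_n) g_sigma_algebra_preimage (X ij.1 ij.2) >>.

Definition mutually_independent (I : finType) (F : I -> set (set T)) : Prop :=
  forall (J : {set I}) (A : I -> set T), (forall i, i \in J -> F i (A i)) ->
    P (\bigcap_(i in [set` J]) A i) = (\prod_(i in J) P (A i))%E.

Definition independent_mx (m n m' n' : nat) (X : 'M[{RV P >-> R}]_(m, n))
    (Y : 'M[{RV P >-> R}]_(m', n')) : Prop :=
  forall A B : set T, sigma_mx X A -> sigma_mx Y B ->
    P (A `&` B) = (P A * P B)%E.

(* V ~ N_k(0, s^2 I_k): independent N(0, s^2) coordinates.  The second argument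
   of normal_prob is the standard deviation. *)
Definition normal_vec (s : R) (k : nat) (V : 'rV[{RV P >-> R}]_k) : Prop :=
  (forall j (B : set R), measurable B ->
     distribution P (V 0 j) B = normal_prob 0 s B) /\
  mutually_independent (fun j => g_sigma_algebra_preimage (V 0 j)).

Definition std_normal_rows (m n : nat) (X : 'M[{RV P >-> R}]_(m, n)) : Prop :=
  (forall i, normal_vec 1 (row i X)) /\
  mutually_independent (fun i => sigma_mx (row i X)).

(* U_k = O_p(a_k) as k tends to infinity. *)
Definition bigO_p (U : nat -> T -> R) (a : nat -> R) : Prop :=
  forall eps : R, 0 < eps -> exists2 M : R, 0 < M &
    \forall k \near \oo, (P [set w | (M * a k < `|U k w|)%R] < eps%:E)%E.

End random_matrices.

(* Main.v *)
Require Import Defs.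
From HB Require Import structures.
From mathcomp Require Import all_boot all_order all_algebra.
From mathcomp Require Import all_classical all_reals all_analysis.
From mathcomp Require Import measurable_realfun ring lra.

Set Implicit Arguments.
Unset Strict Implicit.
Unset Printing Implicit Defensive.

Import Order.TTheory GRing.Theory Num.Theory.
Import numFieldNormedType.Exports.

Local Open Scope classical_set_scope.
Local Open Scope ring_scope.

(** Both estimators arise from ridge regression by putting a random Gram matrix
    in place of a multiple of the identity.  Write [q] for the number of added
    columns of [Z], or of added rows of [W].  Then E[Z Z^T] = q I and
    E[W^T W] = q I, and ridge regression with parameter [q] uses exactly these
    means.  So everything rests on how far the Gram matrix is from its mean,
    compared with [q].

    Deterministic part.  Let B = G^T G + q I, A = G^T G + H^T H and
    E = H^T H - q I.  If the squared Frobenius norm of E is at most q^2 / 4 then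
    H^T H >= (q / 2) I, so A is invertible with |A^-1 u| <= (2 / q) |u|; pairing
    A v with v also gives |G v|^2 <= |u|^2 / q and |H v|^2 <= 2 |u|^2 / q for
    v = A^-1 u ([aug_solve]).  The resolvent identity
    A^-1 - B^-1 = - A^-1 E B^-1 ([aug_resolvent]) is linear in E.
    - For added predictors take G = X^T and H = Z^T.  The push-through identity
      gives beta_ridge = X^T B^-1 y, so the first block of the estimator differs
      from ridge by X^T A^-1 E B^-1 y, whose square is at most
      |E|^2 |y|^2 / q^3, and the second block Z^T A^-1 y has square at most
      2 |y|^2 / q ([min_norm_ols_aug_dev]).
    - For added observations take G = X and H = W.  Then the difference is
      A^-1 E B^-1 X^T y with |B^-1 X^T y|^2 <= |y|^2 / q, hence its square is at
      most 4 |E|^2 |y|^2 / q^3 ([ols_aug_dev]).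

    Probabilistic part.  Every entry of E is a sum of [q] pairwise orthogonal
    variables whose second moments are bounded by an absolute constant, so the
    mean of |E|^2 is O(q) ([mean_at_most_row_gram], [mean_at_most_col_gram]);
    and the mean of |y|^2 is at most a constant times the number of rows of X
    ([mean_at_most_response]).  By Markov's inequality ([bigO_p_dominated])
    |E|^2 / q and |y|^2 over its number of rows are bounded in probability; then
    |E|^2 <= q^2 / 4 holds as soon as [q] is large, and as [q] is at least a
    positive fraction of the index ([linear_remainder]) the deterministic bounds
    become the asserted rates.

    Two points need care.  A measure is constrained on measurable sets only, so
    the estimators are shown to be measurable, inverse matrix included.  And
    independence is a statement on events: the rule E[UV] = E[U] E[V]
    ([independent_meanM]) comes from the uniqueness of product measures and
    Fubini's theorem.  The Gaussian moments come from the fact that a normal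
    density multiplied by exp(a x) or exp(- c x^2) is again proportional to a
    normal density ([normal_tilt]). *)

(** * Quadratic forms and squared norms *)

Definition dotv (R : realType) k (u v : 'cV[R]_k) : R := \sum_i u i 0 * v i 0.

Local Notation "|| v ||2" := (dotv v v) (at level 0, v at level 99).

Definition frob2 (R : realType) m n (A : 'M[R]_(m, n)) : R :=
  \sum_i \sum_j A i j ^+ 2.

Section quadratic_forms.
Variable R : realType.

Lemma dotv_ge0 k (u : 'cV[R]_k) : 0 <= ||u||2.
Proof. by apply: sumr_ge0 => i _; rewrite -expr2 sqr_ge0. Qed.

Lemma dotv_eq0 k (u : 'cV[R]_k) : ||u||2 = 0 -> u = 0.
Proof.
move=> /eqP; rewrite psumr_eq0; last by move=> i _; rewrite -expr2 sqr_ge0.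
move=> /allP u0; apply/colP => i; rewrite mxE.
by have := u0 i (mem_index_enum _); rewrite /= mulf_eq0 orbb => /eqP.
Qed.

Lemma l2normE k (u : 'cV[R]_k) : l2norm u = Num.sqrt ||u||2.
Proof. by congr Num.sqrt; apply: eq_bigr => i _; rewrite expr2. Qed.

Lemma dotvE k (u v : 'cV[R]_k) : dotv u v = (u^T *m v) 0 0.
Proof. by rewrite mxE; apply: eq_bigr => i _; rewrite mxE. Qed.

Lemma dotv_mulmxl m k (A : 'M[R]_(m, k)) u v :
  dotv (A *m u) v = dotv u (A^T *m v).
Proof. by rewrite !dotvE trmx_mul mulmxA. Qed.

Lemma dotvDr k (u v w : 'cV[R]_k) : dotv u (v + w) = dotv u v + dotv u w.
Proof. by rewrite !dotvE mulmxDr mxE. Qed.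

Lemma dotvZr k a (u v : 'cV[R]_k) : dotv u (a *: v) = a * dotv u v.
Proof. by rewrite !dotvE -scalemxAr mxE. Qed.

Lemma dotvNr k (u v : 'cV[R]_k) : dotv u (- v) = - dotv u v.
Proof. by rewrite -scaleN1r dotvZr mulN1r. Qed.

Lemma dotvNN k (u : 'cV[R]_k) : ||- u||2 = ||u||2.
Proof. by apply: eq_bigr => i _; rewrite mxE mulrNN. Qed.

(** Young's inequality is used in place of Cauchy-Schwarz because all the bounds
    below are on squared norms: a cross term is split between the two squares,
    with the weight [a] chosen so that one of them can be absorbed. *)
Lemma dotv_young k (a : R) (u v : 'cV[R]_k) : 0 < a ->
  dotv u v <= a * ||u||2 + ||v||2 / (4 * a).
Proof.
move=> a0; rewrite /dotv mulr_sumr mulr_suml -big_split /=.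
apply: ler_sum => i _; rewrite -subr_ge0.
have -> : a * (u i 0 * u i 0) + v i 0 * v i 0 / (4 * a) - u i 0 * v i 0 =
  (a * u i 0 - v i 0 / 2) ^+ 2 / a by field; lra.
by rewrite divr_ge0 ?sqr_ge0// ltW.
Qed.

Lemma sqr_sum_le (I : finType) (a b : I -> R) :
  (\sum_i a i * b i) ^+ 2 <= (\sum_i a i ^+ 2) * \sum_i b i ^+ 2.
Proof.
pose A := \sum_i a i ^+ 2; pose B := \sum_i b i ^+ 2; pose C := \sum_i a i * b i.
have A0 : 0 <= A by apply: sumr_ge0 => i _; rewrite sqr_ge0.
have H x y : 0 <= x ^+ 2 * A + y ^+ 2 * B - 2 * (x * y) * C.
  rewrite /A /B /C !mulr_sumr -big_split -sumrB/=; apply: sumr_ge0 => i _.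
  rewrite (_ : _ - _ = (x * a i - y * b i) ^+ 2) ?sqr_ge0//; ring.
rewrite -/A -/B -/C.
have [A00|A1] := eqVneq A 0; last first.
  rewrite -(ler_pM2l (_ : 0 < A)) ?lt_def ?A1// -subr_ge0.
  have := H C A; rewrite (_ : _ + _ - _ = A * (A * B) - A * C ^+ 2)//; ring.
have /(_ _)/eqP a0 : forall i, a i == 0.
  move=> i; have /eqP := A00; rewrite psumr_eq0; last first.
    by move=> j _; rewrite sqr_ge0.
  by move=> /allP/(_ i (mem_index_enum _)) /=; rewrite sqrf_eq0.
rewrite A00 mul0r /C big1 ?expr0n// => i _; by rewrite a0 mul0r.
Qed.

Lemma frob2_ge0 m n (A : 'M[R]_(m, n)) : 0 <= frob2 A.
Proof. by apply: sumr_ge0 => i _; apply: sumr_ge0 => j _; rewrite sqr_ge0. Qed.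

(** Cauchy-Schwarz on each row; this is how the Frobenius norm, whose mean is
    computable, controls the operator norm. *)
Lemma mulmx_frob2 m n (A : 'M[R]_(m, n)) u : ||A *m u||2 <= frob2 A * ||u||2.
Proof.
rewrite /dotv /frob2 mulr_suml; apply: ler_sum => i _.
rewrite mxE -expr2; apply: le_trans (sqr_sum_le _ _) _.
by under [X in _ * X <= _]eq_bigr do rewrite expr2.
Qed.

Lemma unitmx_inj n (A : 'M[R]_n) :
  (forall v : 'cV_n, A *m v = 0 -> v = 0) -> A \in unitmx.
Proof.
move=> inj; rewrite -unitmx_tr -row_free_unit; apply/row_freeP.
suff /row_freeP : row_free A^T by [].
rewrite -kermx_eq0; apply/eqP/row_matrixP => i; rewrite row0.
apply: trmx_inj; rewrite trmx0; apply: inj.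
have := mulmx_ker A^T => /(congr1 (row i)); rewrite row_mul row0 => k0.
by apply: trmx_inj; rewrite trmx_mul trmxK trmx0.
Qed.

End quadratic_forms.

(** * Perturbation of the ridge system *)

Section perturbation.
Variable R : realType.
Variables n p m : nat.
Variables (G : 'M[R]_(p, n)) (H : 'M[R]_(m, n)) (q : R).
Hypothesis q_gt0 : 0 < q.

Let q2_gt0 : 0 < q / 2. Proof. exact: divr_gt0. Qed.

Lemma ridge_quadratic v : dotv v ((G^T *m G + q%:M) *m v) = ||G *m v||2 + q * ||v||2.
Proof. by rewrite mulmxDl dotvDr mul_scalar_mx dotvZr -mulmxA dotv_mulmxl. Qed.

Lemma ridge_unit : G^T *m G + q%:M \in unitmx.
Proof.
apply: unitmx_inj => v Bv0; apply: dotv_eq0.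
have := ridge_quadratic v; rewrite Bv0 dotvE mulmx0 mxE => E0.
apply/eqP; rewrite eq_le dotv_ge0 andbT -(pmulr_rle0 _ q_gt0).
by have := dotv_ge0 (G *m v); lra.
Qed.

Lemma ridge_solve u : ||invmx (G^T *m G + q%:M) *m u||2 <= ||u||2 / q ^+ 2.
Proof.
have q0 := q_gt0.
set v := _ *m u.
have := ridge_quadratic v; rewrite {2}/v mulKVmx ?ridge_unit// => E.
have := dotv_young v u q2_gt0; rewrite E.
have := dotv_ge0 (G *m v).
rewrite (_ : 4 * (q / 2) = 2 * q); last by field.
rewrite ler_pdivlMr ?exprn_gt0//.
have -> : ||u||2 / (2 * q) = (||u||2 / q) / 2 by field; lra.
rewrite -[X in _ -> _ -> _ <= X](@mulfVK _ q) ?gt_eqF//.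
by set t := _ / q; move=> *; nra.
Qed.

(** The square |G v|^2 produced by the quadratic form absorbs the cross term
    (G v).u, so [G^T] costs nothing: no bound on the size of [G] enters. *)
Lemma ridge_solve_tr (u : 'cV_p) :
  ||invmx (G^T *m G + q%:M) *m (G^T *m u)||2 <= ||u||2 / q.
Proof.
have q0 := q_gt0.
set v := _ *m (G^T *m u).
have := ridge_quadratic v; rewrite {2}/v mulKVmx ?ridge_unit// => E.
have := dotv_young (G *m v) u ltr01; rewrite dotv_mulmxl E.
have := dotv_ge0 u; rewrite ler_pdivlMr// mulr1 mul1r => u0.
by move: (||v||2) (||u||2) u0 => a b *; lra.
Qed.

Let q4_gt0 : 0 < q / 4. Proof. exact: divr_gt0. Qed.

(* A quarter leaves room: the operator norm of the deviation is at most q / 2,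
   so half of [q] survives as a lower bound for [H^T *m H]. *)
Hypothesis HE : frob2 (H^T *m H - q%:M) <= q ^+ 2 / 4.

Let A := G^T *m G + H^T *m H.

Lemma gram_ge v : q / 2 * ||v||2 <= ||H *m v||2.
Proof.
have q0 := q_gt0.
have -> : ||H *m v||2 = q * ||v||2 - dotv v (- ((H^T *m H - q%:M) *m v)).
  rewrite dotvNr opprK mulmxBl dotvDr dotvNr mul_scalar_mx dotvZr -mulmxA.
  by rewrite -dotv_mulmxl; ring.
have := dotv_young v (- ((H^T *m H - q%:M) *m v)) q4_gt0.
rewrite dotvNN (_ : 4 * (q / 4) = q); last by field.
have : ||(H^T *m H - q%:M) *m v||2 / q <= q / 4 * ||v||2.
  rewrite ler_pdivrMr//; apply: le_trans (mulmx_frob2 _ _) _.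
  rewrite mulrAC (_ : _ * q = q ^+ 2 / 4); last by field.
  by rewrite ler_wpM2r ?dotv_ge0.
lra.
Qed.

Lemma aug_quadratic v : dotv v (A *m v) = ||G *m v||2 + ||H *m v||2.
Proof. by rewrite mulmxDl dotvDr -!mulmxA -!dotv_mulmxl. Qed.

Lemma aug_unit : A \in unitmx.
Proof.
apply: unitmx_inj => v Av0; apply: dotv_eq0.
have := aug_quadratic v; rewrite Av0 dotvE mulmx0 mxE => E0.
apply/eqP; rewrite eq_le dotv_ge0 andbT -(pmulr_rle0 _ q_gt0).
by have := gram_ge v; have := dotv_ge0 (G *m v); lra.
Qed.

(** Here |H v|^2 plays the role of q |v|^2 in the ridge system, up to a factor
    two; the three bounds come from the one quadratic identity. *)
Lemma aug_solve u : let v := invmx A *m u in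
  [/\ ||v||2 <= 4 * ||u||2 / q ^+ 2, ||G *m v||2 <= ||u||2 / q &
      ||H *m v||2 <= 2 * ||u||2 / q].
Proof.
have q0 := q_gt0.
move=> v.
have := aug_quadratic v; rewrite [_ *m v]mulKVmx ?aug_unit// => E.
have := gram_ge v.
have := dotv_young v u q4_gt0; rewrite E.
have := dotv_ge0 (G *m v); have := dotv_ge0 v.
rewrite (_ : 4 * (q / 4) = q); last by field.
rewrite !ler_pdivlMr ?exprn_gt0//.
rewrite -[||u||2](@mulfVK _ q) ?gt_eqF// mulfK ?gt_eqF//.
set t := _ / q; set a := ||v||2; set b := ||G *m v||2; set c := ||H *m v||2.
move=> a0 b0 h1 h2.
have h3 : q * a <= 4 * t by lra.
have qa0 : 0 <= q * a by apply: mulr_ge0 => //; exact: ltW.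
split; last 2 first.
- by rewrite ler_pM2r//; lra.
- by rewrite [leRHS]mulrA ler_pM2r//; lra.
by have := ler_wpM2r (ltW q_gt0) h3; lra.
Qed.

(** The term between the two inverses is the difference of the two matrices, so
    the error of the estimators is linear in the Gram deviation. *)
Lemma aug_resolvent (u : 'cV_n) :
  invmx A *m u - invmx (G^T *m G + q%:M) *m u =
  - (invmx A *m ((H^T *m H - q%:M) *m (invmx (G^T *m G + q%:M) *m u))).
Proof.
set v := invmx (G^T *m G + q%:M) *m u.
have -> : (H^T *m H - q%:M) = A - (G^T *m G + q%:M).
  by rewrite /A [G^T *m G + H^T *m H]addrC addrKA.
have Bv : (G^T *m G + q%:M) *m v = u by rewrite mulKVmx ?ridge_unit.
by rewrite mulmxBl Bv mulmxBr mulKmx ?aug_unit// opprB.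
Qed.

End perturbation.

(** * Deterministic error bounds for the estimators *)

Section estimators.
Variable R : realType.

(** The push-through identity B' X^T = X^T B for B = X X^T + lambda I and
    B' = X^T X + lambda I moves ridge regression to the n-dimensional side,
    where the minimum norm estimator lives. *)
Lemma ridge_pushthrough n p (lambda : R) (X : 'M[R]_(n, p)) y : 0 < lambda ->
  ridge lambda X y = X^T *m (invmx (X *m X^T + lambda%:M) *m y).
Proof.
move=> l0; rewrite /ridge.
have u1 := ridge_unit X l0; have u2 := ridge_unit X^T l0.
rewrite trmxK in u2.
have E : X^T *m (X *m X^T + lambda%:M) = (X^T *m X + lambda%:M) *m X^T.
  by rewrite mulmxDr mulmxDl mulmxA mul_scalar_mx mul_mx_scalar.
have -> : invmx (X^T *m X + lambda%:M) *m X^T = X^T *m invmx (X *m X^T + lambda%:M).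
  by rewrite -[RHS](mulKmx u1) [_ *m (X^T *m _)]mulmxA -E mulmxK.
by rewrite mulmxA.
Qed.

(** [X^T] is absorbed by the bound on |G v|^2 with G = X^T, which gains a factor
    q^-1 over |v|^2 without any bound on [X]. *)
Lemma min_norm_ols_aug_dev n p k (q : R) (X : 'M[R]_(n, p)) (Z : 'M[R]_(n, k)) y :
  0 < q -> frob2 (Z *m Z^T - q%:M) <= q ^+ 2 / 4 ->
  ||usubmx (min_norm_ols_aug X Z y) - ridge q X y||2 <=
    frob2 (Z *m Z^T - q%:M) * ||y||2 / q ^+ 3 /\
  ||dsubmx (min_norm_ols_aug X Z y)||2 <= 2 * ||y||2 / q.
Proof.
move=> q0 hE.
have gramE k' (M : 'M[R]_(n, k')) : M *m M^T = M^T^T *m M^T by rewrite trmxK.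
rewrite gramE in hE *.
have S u := aug_solve X^T q0 hE u.
rewrite /min_norm_ols_aug !gramE tr_row_mx -mulmxA mul_col_mx col_mxKu col_mxKd.
rewrite ridge_pushthrough// gramE -mulmxBr.
split; last by have [] := S y.
rewrite aug_resolvent// mulmxN dotvNN.
have [_ + _] := S ((Z^T^T *m Z^T - q%:M) *m (invmx (X^T^T *m X^T + q%:M) *m y)).
move=> /le_trans; apply.
have := mulmx_frob2 (Z^T^T *m Z^T - q%:M) (invmx (X^T^T *m X^T + q%:M) *m y).
set f := frob2 _ => h.
have := ridge_solve X^T q0 y; rewrite /= => h2.
have f0 : 0 <= f := frob2_ge0 _.
rewrite (_ : _ / q ^+ 3 = f * (||y||2 / q ^+ 2) / q); last by field; lra.
rewrite ler_pM2r ?invr_gt0//; apply: le_trans h _.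
exact: ler_wpM2l.
Qed.

Lemma ols_aug_dev n p k (q : R) (X : 'M[R]_(n, p)) (W : 'M[R]_(k, p)) y :
  0 < q -> frob2 (W^T *m W - q%:M) <= q ^+ 2 / 4 ->
  ||ols_aug X W y - ridge q X y||2 <=
    4 * frob2 (W^T *m W - q%:M) * ||y||2 / q ^+ 3.
Proof.
move=> q0 hE; rewrite /ols_aug /ridge -!(mulmxA (invmx _)).
rewrite aug_resolvent// dotvNN.
set w := _ *m (invmx _ *m (X^T *m y)).
have [+ _ _] := aug_solve X q0 hE w.
move=> /le_trans; apply.
have := ridge_solve_tr X q0 y; rewrite /= => h2.
have := mulmx_frob2 (W^T *m W - q%:M) (invmx (X^T *m X + q%:M) *m (X^T *m y)).
rewrite -/w; set f := frob2 _ => h.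
have f0 : 0 <= f := frob2_ge0 _.
rewrite (_ : _ / q ^+ 3 = 4 * (f * (||y||2 / q)) / q ^+ 2); last by field; lra.
rewrite ler_pM2r ?invr_gt0 ?exprn_gt0// ler_pM2l//; apply: le_trans h _.
exact: ler_wpM2l.
Qed.

End estimators.

(** * Measurability of matrix-valued functions *)

Section measurable_matrices.
Context d (T : measurableType d) (R : realType).

Definition measurable_mx m n (A : T -> 'M[R]_(m, n)) :=
  forall i j, measurable_fun setT (fun w => A w i j).

(** The inverse is discontinuous at 0, where it takes the value 0; the identity
    x^-1 = x (x^2)^-1 reduces it to the measurable power function. *)
Lemma measurable_funVr (f : T -> R) : measurable_fun setT f ->
  measurable_fun setT (fun w => (f w)^-1).
Proof.
move=> mf.
have -> : (fun w => (f w)^-1) = (fun w => f w * (f w ^+ 2) `^ (-1)).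
  apply/funext => w; rewrite powR_inv1 ?sqr_ge0//.
  have [->|f0] := eqVneq (f w) 0; first by rewrite invr0 mul0r.
  by field.
apply: measurable_funM => //.
apply: (measurableT_comp (measurable_powR _)).
exact: measurable_funX.
Qed.

Lemma measurable_mx_cst m n (A : 'M[R]_(m, n)) : measurable_mx (fun=> A).
Proof. by move=> i j; exact: measurable_cst. Qed.

Lemma measurable_mxD m n (A B : T -> 'M[R]_(m, n)) :
  measurable_mx A -> measurable_mx B -> measurable_mx (fun w => A w + B w).
Proof.
move=> mA mB i j; under eq_fun do rewrite mxE.
exact: measurable_funD.
Qed.

Lemma measurable_mxN m n (A : T -> 'M[R]_(m, n)) :
  measurable_mx A -> measurable_mx (fun w => - A w).
Proof.
move=> mA i j; under eq_fun do rewrite mxE.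
exact: measurable_funN.
Qed.

Lemma measurable_mxB m n (A B : T -> 'M[R]_(m, n)) :
  measurable_mx A -> measurable_mx B -> measurable_mx (fun w => A w - B w).
Proof. by move=> mA mB; apply: measurable_mxD => //; exact: measurable_mxN. Qed.

Lemma measurable_mxM m n p (A : T -> 'M[R]_(m, n)) (B : T -> 'M[R]_(n, p)) :
  measurable_mx A -> measurable_mx B -> measurable_mx (fun w => A w *m B w).
Proof.
move=> mA mB i j; under eq_fun do rewrite mxE.
by apply: measurable_sum => k; exact: measurable_funM.
Qed.

Lemma measurable_mxT m n (A : T -> 'M[R]_(m, n)) :
  measurable_mx A -> measurable_mx (fun w => (A w)^T).
Proof. by move=> mA i j; under eq_fun do rewrite mxE; exact: mA. Qed.

Lemma measurable_usubmx m1 m2 n (A : T -> 'M[R]_(m1 + m2, n)) :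
  measurable_mx A -> measurable_mx (fun w => usubmx (A w)).
Proof. by move=> mA i j; under eq_fun do rewrite mxE; exact: mA. Qed.

Lemma measurable_dsubmx m1 m2 n (A : T -> 'M[R]_(m1 + m2, n)) :
  measurable_mx A -> measurable_mx (fun w => dsubmx (A w)).
Proof. by move=> mA i j; under eq_fun do rewrite mxE; exact: mA. Qed.

Lemma measurable_row_mx m n1 n2 (A : T -> 'M[R]_(m, n1)) (B : T -> 'M[R]_(m, n2)) :
  measurable_mx A -> measurable_mx B -> measurable_mx (fun w => row_mx (A w) (B w)).
Proof.
by move=> mA mB i j; under eq_fun do rewrite mxE; case: (fintype.split j) => k;
  [exact: mA|exact: mB].
Qed.

Lemma measurable_det n (A : T -> 'M[R]_n) :
  measurable_mx A -> measurable_fun setT (fun w => \det (A w)).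
Proof.
move=> mA; apply: measurable_sum => s; apply: measurable_funM => //.
by apply: measurable_prod => i _; exact: mA.
Qed.

(** [invmx] is the cofactor formula where the determinant is not 0 and the
    identity map elsewhere. *)
Lemma measurable_invmx n (A : T -> 'M[R]_n) :
  measurable_mx A -> measurable_mx (fun w => invmx (A w)).
Proof.
move=> mA i j.
have -> : (fun w => invmx (A w) i j) = (fun w =>
    if \det (A w) == 0 then A w i j else (\det (A w))^-1 * cofactor (A w) j i).
  apply/funext => w; rewrite /invmx unitmxE unitfE.
  by case: eqP => _ //=; rewrite !mxE.
have mdet := measurable_det mA.
apply: measurable_fun_ifT; [exact: measurable_fun_eqr|exact: mA|].
apply: measurable_funM; first exact: measurable_funVr.
apply: measurable_funM => //; apply: measurable_det => k l.
by under eq_fun do rewrite !mxE; exact: mA.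
Qed.

Lemma measurable_eval_mx (P : probability T R) m n (X : 'M[{RV P >-> R}]_(m, n)) :
  measurable_mx (eval_mx X).
Proof. by move=> i j; under eq_fun do rewrite mxE; exact: measurable_funP. Qed.

Lemma measurable_l2norm k (v : T -> 'cV[R]_k) :
  measurable_mx v -> measurable_fun setT (fun w => l2norm (v w)).
Proof.
move=> mv; apply: (measurableT_comp (continuous_measurable_fun (@sqrt_continuous R))).
by apply: measurable_sum => i; exact: measurable_funX.
Qed.

Lemma measurable_ridge n p lambda (X : T -> 'M[R]_(n, p)) y :
  measurable_mx X -> measurable_mx y ->
  measurable_mx (fun w => ridge lambda (X w) (y w)).
Proof.
move=> mX my; apply: measurable_mxM => //.
apply: measurable_mxM; last exact: measurable_mxT.
apply: measurable_invmx; apply: measurable_mxD; last exact: measurable_mx_cst.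
by apply: measurable_mxM => //; exact: measurable_mxT.
Qed.

Lemma measurable_ols_aug n k p (X : T -> 'M[R]_(n, p)) (W : T -> 'M[R]_(k, p)) y :
  measurable_mx X -> measurable_mx W -> measurable_mx y ->
  measurable_mx (fun w => ols_aug (X w) (W w) (y w)).
Proof.
move=> mX mW my; apply: measurable_mxM => //.
apply: measurable_mxM; last exact: measurable_mxT.
apply: measurable_invmx; apply: measurable_mxD;
  by apply: measurable_mxM => //; exact: measurable_mxT.
Qed.

Lemma measurable_min_norm_ols_aug n p k (X : T -> 'M[R]_(n, p))
    (Z : T -> 'M[R]_(n, k)) y :
  measurable_mx X -> measurable_mx Z -> measurable_mx y ->
  measurable_mx (fun w => min_norm_ols_aug (X w) (Z w) (y w)).
Proof.
move=> mX mZ my; apply: measurable_mxM => //; apply: measurable_mxM.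
  exact/measurable_mxT/measurable_row_mx.
apply: measurable_invmx; apply: measurable_mxD;
  by apply: measurable_mxM => //; exact: measurable_mxT.
Qed.

End measurable_matrices.

(** * Means *)

Section means.
Context d (T : measurableType d) (R : realType) (P : probability T R).
Implicit Types f g : T -> R.

(** Integrability and the value of the integral are kept together, so that means
    of sums, multiples and independent products can be chained without separate
    integrability goals. *)
Definition has_mean f (m : R) :=
  P.-integrable setT (EFin \o f) /\ (\int[P]_w (f w)%:E = m%:E)%E.

Lemma has_mean_measurable f m : has_mean f m -> measurable_fun setT f.
Proof. by move=> [/measurable_int/measurable_EFinP]. Qed.

Lemma eq_has_mean f g m : f =1 g -> has_mean f m -> has_mean g m.
Proof. by move=> /funext ->. Qed.

Lemma has_mean_cst c : has_mean (fun=> c) c.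
Proof.
split; first by apply: finite_measure_integrable_cst.
by rewrite integral_cst//=; have -> := @probability_setT _ _ _ P; rewrite mule1.
Qed.

Lemma has_meanD f g a b : has_mean f a -> has_mean g b ->
  has_mean (fun w => f w + g w) (a + b).
Proof.
move=> [fi fE] [gi gE]; split.
  by apply: eq_integrable (integrableD _ fi gi).
by rewrite integralD_EFin// fE gE.
Qed.

Lemma has_meanZ c f a : has_mean f a -> has_mean (fun w => c * f w) (c * a).
Proof.
move=> [fi fE]; split.
  by apply: eq_integrable (integrableZl _ c fi).
by under eq_integral do rewrite EFinM; rewrite integralZl// fE.
Qed.

Lemma has_mean_sum (I : Type) (s : seq I) (f : I -> T -> R) (a : I -> R) :
  (forall i, has_mean (f i) (a i)) ->
  has_mean (fun w => \sum_(i <- s) f i w) (\sum_(i <- s) a i).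
Proof.
move=> fa; elim: s => [|i s ih].
  by under eq_fun do rewrite big_nil; rewrite big_nil; exact: has_mean_cst.
by under eq_fun do rewrite big_cons; rewrite big_cons; exact: has_meanD.
Qed.

Lemma has_mean_le f g a b : has_mean f a -> has_mean g b ->
  (forall w, f w <= g w) -> a <= b.
Proof.
move=> [fi fE] [gi gE] fg; rewrite -lee_fin -fE -gE.
by apply: le_integral => // w _; rewrite lee_fin.
Qed.

Lemma has_mean_dominated f g b : measurable_fun setT f -> has_mean g b ->
  (forall w, `|f w| <= g w) -> exists a, has_mean f a.
Proof.
move=> mf [gi gE] fg.
have fi : P.-integrable setT (EFin \o f).
  apply: le_integrable gi => //; first exact/measurable_EFinP.
  by move=> w _ /=; rewrite lee_fin (le_trans (fg w))// ler_norm.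
exists (fine (\int[P]_w (f w)%:E)); split => //.
by rewrite fineK//; exact: integrable_fin_num.
Qed.

Lemma measurable_gt_set c f : measurable_fun setT f ->
  measurable [set w | c < f w].
Proof.
move=> mf.
have := measurable_fun_ltr (@measurable_cst _ _ T R setT c) mf.
by move=> /(_ measurableT [set true] I); rewrite setTI.
Qed.

Lemma has_mean_markov f a c : has_mean f a -> (forall w, 0 <= f w) -> 0 < c ->
  (P [set w | (c < f w)%R] <= (a / c)%:E)%E.
Proof.
move=> fa f0 c0; have mf := has_mean_measurable fa; case: fa => fi fE.
have mA := measurable_gt_set c mf.
rewrite EFinM lee_pdivlMr// -fE muleC -integral_cst//.
apply: (@le_trans _ _ (\int[P]_(w in [set w | (c < f w)%R]) (f w)%:E)%E).
  apply: ge0_le_integral => //=.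
  - by move=> w _; rewrite lee_fin ltW.
  - exact/measurable_EFinP/measurable_funTS.
  - by move=> w /ltW; rewrite lee_fin.
apply: ge0_subset_integral => //=.
- exact/measurable_EFinP.
- by move=> w _; rewrite lee_fin.
Qed.

End means.

(** * Independence and products *)

Section independence.
Context d (T : measurableType d) (R : realType) (P : probability T R).
Implicit Types U V : T -> R.

Definition independent_fun U V := forall A B : set R, measurable A -> measurable B ->
  P (U @^-1` A `&` V @^-1` B) = (P (U @^-1` A) * P (V @^-1` B))%E.

Lemma independent_fun_comp U V (g h : R -> R) :
  measurable_fun setT g -> measurable_fun setT h ->
  independent_fun U V -> independent_fun (g \o U) (h \o V).
Proof.
move=> mg mh UV A B mA mB.
have mgA : measurable (g @^-1` A) by rewrite -[X in measurable X]setTI; exact: mg.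
have mhB : measurable (h @^-1` B) by rewrite -[X in measurable X]setTI; exact: mh.
exact: (UV _ _ mgA mhB).
Qed.

Section product_law.
Variables (U V : {mfun T >-> R}).
Hypothesis UV : independent_fun U V.

Let m1 := distribution P U.
Let m2 := distribution P V.
Let UVm : measurable_fun setT (fun w => (U w, V w)).
Proof. by apply/measurable_fun_pair. Qed.

Let pair_mfun : {mfun T >-> (R * R)%type} :=
  HB.pack (fun w => (U w, V w)) (isMeasurableFun.Build _ _ _ _ _ UVm).

(** Two measures that agree on rectangles are equal, so the joint law of
    independent variables is the product of their laws. *)
Lemma product_law X : measurable X ->
  (m1 \x m2)%E X = distribution P pair_mfun X.
Proof.
by apply: product_measure_unique => A B mA mB; exact: UV.
Qed.

Lemma ge0_integral_product_law (f : R * R -> \bar R) :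
  measurable_fun setT f -> (forall z, 0 <= f z)%E ->
  (\int[P]_w f (U w, V w) = \int[m1]_x \int[m2]_y f (x, y))%E.
Proof.
move=> mf f0.
rewrite -[RHS](@fubini_tonelli1 _ _ _ _ _ (distribution P U) (distribution P V) f)//.
rewrite (eq_measure_integral (distribution P pair_mfun)); last first.
  by move=> A mA _; exact: product_law.
by rewrite ge0_integral_distribution.
Qed.

Lemma integral_product_law (f : R * R -> \bar R) :
  measurable_fun setT f -> P.-integrable setT (fun w => f (U w, V w)) ->
  (\int[P]_w f (U w, V w) = \int[m1]_x \int[m2]_y f (x, y))%E.
Proof.
move=> mf fi.
rewrite -[LHS](@integral_distribution _ _ _ _ _ P pair_mfun f)//.
rewrite (eq_measure_integral (m1 \x m2)%E); last first.
  by move=> A mA _; apply/esym; exact: product_law.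
rewrite integral12_prod_meas1//; apply/integrableP; split => //.
rewrite (eq_measure_integral (distribution P pair_mfun)); last first.
  by move=> A mA _; exact: product_law.
rewrite ge0_integral_distribution//; last exact: measurableT_comp.
by have /integrableP[] := fi.
Qed.

(** Tonelli for |UV| gives integrability, after which Fubini gives the value. *)
Lemma mfun_independent_meanM a b : has_mean P U a -> has_mean P V b ->
  has_mean P (fun w => U w * V w) (a * b).
Proof.
move=> [Ui UE] [Vi VE].
have m12 : measurable_fun [set: R * R] (fun z => z.1 * z.2).
  by apply: measurable_funM; [exact: measurable_fst|exact: measurable_snd].
have mabs : measurable_fun [set: R] (fun x : R => `|x%:E|%E).
  by apply: measurableT_comp => //; exact/measurable_EFinP.
have lty (W : {mfun T >-> R}) : P.-integrable setT (EFin \o W) ->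
    (0 <= \int[distribution P W]_x `|x%:E| < +oo)%E.
  move=> /integrableP[_ Wi]; rewrite integral_ge0//=.
  by rewrite ge0_integral_distribution.
have UVi : P.-integrable setT (EFin \o (fun w => U w * V w)).
  apply/integrableP; split.
    by apply/measurable_EFinP; exact: measurable_funM.
  rewrite /= (@ge0_integral_product_law (fun z => `|(z.1 * z.2)%:E|)%E)//; last first.
    by apply: measurableT_comp => //; exact/measurable_EFinP.
  have /andP[U0 Uy] := lty _ Ui; have /andP[V0 Vy] := lty _ Vi.
  have inner x : (\int[m2]_y `|(x * y)%:E| = `|x%:E| * \int[m2]_y `|y%:E|)%E.
    by under eq_integral do rewrite EFinM abseM; rewrite ge0_integralZl.
  under eq_integral do rewrite inner.
  by rewrite ge0_integralZr//; apply: lte_mul_pinfty => //; rewrite ge0_fin_numE.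
split=> //.
rewrite (@integral_product_law (fun z => (z.1 * z.2)%:E))//; last first.
  exact/measurable_EFinP.
have idi (W : {mfun T >-> R}) : P.-integrable setT (EFin \o W) ->
    (distribution P W).-integrable setT EFin.
  by move=> Wi; apply: integrable_pushforward.
have inner x : (\int[m2]_y (x * y)%:E = x%:E * b%:E)%E.
  under eq_integral do rewrite EFinM.
  rewrite integralZl//; last exact: idi.
  by rewrite integral_distribution// VE.
under eq_integral do rewrite inner.
rewrite integralZr//; last exact: idi.
by rewrite integral_distribution// UE.
Qed.

End product_law.

Lemma independent_meanM U V a b : independent_fun U V ->
  has_mean P U a -> has_mean P V b -> has_mean P (fun w => U w * V w) (a * b).
Proof.
move=> UV Ua Vb.
pose U' : {mfun T >-> R} :=
  HB.pack U (isMeasurableFun.Build _ _ _ _ _ (has_mean_measurable Ua)).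
pose V' : {mfun T >-> R} :=
  HB.pack V (isMeasurableFun.Build _ _ _ _ _ (has_mean_measurable Vb)).
exact: (@mfun_independent_meanM U' V' UV).
Qed.

End independence.

(** * Moments of the normal law *)

Section gaussian.
Context d (T : measurableType d) (R : realType) (P : probability T R).
Notation mu := (@lebesgue_measure R).

Definition centred_normal (s : R) (U : {mfun T >-> R}) :=
  forall B : set R, measurable B -> distribution P U B = normal_prob 0 s B.

(** The Radon-Nikodym derivative of a normal law with respect to Lebesgue measure
    agrees almost everywhere with the explicit density. *)
Lemma ge0_integral_normal_prob (m s : R) (h : R -> \bar R) :
  measurable_fun setT h -> (forall x, 0 <= h x)%E ->
  (\int[normal_prob m s]_x h x = \int[mu]_x (h x * (normal_pdf m s x)%:E))%E.
Proof.
move=> mh h0.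
have dom := @normal_prob_dominates R m s.
rewrite -(Radon_Nikodym_SigmaFinite.change_of_variables dom)//.
have mRN := measurable_int _ (Radon_Nikodym_SigmaFinite.f_integrable dom).
have mpdf := @measurable_normal_pdf R m s.
apply: ae_eq_integral => //.
- exact: emeasurable_funM.
- by apply: emeasurable_funM => //; exact/measurable_EFinP.
apply: ae_eqe_mul2l; apply: integral_ae_eq => //.
- exact: Radon_Nikodym_SigmaFinite.f_integrable.
- exact/measurable_EFinP.
- by move=> E _ mE; rewrite -Radon_Nikodym_SigmaFinite.f_integral.
Qed.

(** A normal density has total mass 1 whatever its parameters, so an exponential
    moment is read off from the factor [c] without computing an integral. *)
Lemma normal_tilt (s : R) U (h : R -> R) (c m s' : R) :
  centred_normal s U -> measurable_fun setT h -> (forall x, 0 <= h x) ->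
  (forall x, h x * normal_pdf 0 s x = c * normal_pdf m s' x) ->
  has_mean P (h \o U) c.
Proof.
move=> Us mh h0 tilt.
have hE : (\int[P]_w (h (U w))%:E = c%:E)%E.
  (* The same function, with the display that Lebesgue measure lives on. *)
  have mU : measurable_fun setT (U : T -> measurableTypeR R).
    by move=> mD Y mY; exact: (@measurable_funPT _ _ _ _ U mD Y mY).
  pose U' : {mfun T >-> measurableTypeR R} :=
    HB.pack (U : T -> measurableTypeR R) (isMeasurableFun.Build _ _ _ _ _ mU).
  rewrite -[LHS](@ge0_integral_distribution _ _ _ _ _ P U' (EFin \o h))//; last first.
    exact/measurable_EFinP.
  rewrite (eq_measure_integral (normal_prob 0 s)); last first.
    by move=> A mA _; exact: Us.
  rewrite ge0_integral_normal_prob//; last exact/measurable_EFinP.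
  under eq_integral do rewrite /= -EFinM tilt EFinM.
  rewrite integralZl//; last exact: integrable_normal_pdf.
  by rewrite integral_normal_pdf mule1.
split=> //; apply/integrableP; split.
  by apply/measurable_EFinP; exact: measurableT_comp.
under eq_integral do rewrite /= ger0_norm//.
by rewrite hE ltry.
Qed.

(** The tilt by exp(- (r^2 - 1) x^2 / (2 s^2)) divides the standard deviation
    by [r]; small [r] gives growing exponentials. *)
Lemma has_mean_exp_sqr s U r : s != 0 -> 0 < r -> centred_normal s U ->
  has_mean P (fun w => expR (- ((r ^+ 2 - 1) / (2 * s ^+ 2) * U w ^+ 2))) r^-1.
Proof.
move=> s0 r0 Us.
have rn0 : r != 0 by rewrite gt_eqF.
have sr0 : s / r != 0 by rewrite mulf_neq0 ?invr_eq0.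
pose h x := expR (- ((r ^+ 2 - 1) / (2 * s ^+ 2) * x ^+ 2)).
apply: (@normal_tilt s U h _ 0 (s / r)) => //.
- by apply: measurableT_comp => //; apply: measurableT_comp => //;
    apply: measurable_funM => //; exact: measurable_funX.
- by move=> x; exact: expR_ge0.
- move=> x; rewrite !normal_pdfE// mulrCA.
  have -> : normal_peak (s / r) = r * normal_peak s.
    rewrite /normal_peak.
    have -> : (s / r) ^+ 2 * pi *+ 2 = r^-1 ^+ 2 * (s ^+ 2 * pi *+ 2).
      by rewrite exprMn; ring.
    by rewrite sqrtrM ?sqr_ge0// sqrtr_sqr ger0_norm ?invr_ge0 ?ltW// invfM invrK.
  rewrite !mulrA mulVf// mul1r -mulrA; congr (_ * _).
  rewrite /h /normal_fun -expRD; congr expR.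
  by field; rewrite s0 rn0.
Qed.

(** Completing the square: the tilt by exp(a x) moves the mean to a s^2. *)
Lemma has_mean_exp s U a : s != 0 -> centred_normal s U ->
  has_mean P (fun w => expR (a * U w)) (expR (a ^+ 2 * s ^+ 2 / 2)).
Proof.
move=> s0 Us.
apply: (@normal_tilt s U (fun x => expR (a * x)) _ (a * s ^+ 2) s) => //.
- by apply: measurableT_comp => //; exact: measurable_funM.
- move=> x /=; rewrite !normal_pdfE// mulrCA [in RHS]mulrCA; congr (_ * _).
  rewrite /normal_fun -!expRD; congr expR.
  by field.
Qed.

Lemma sqr_le_expR (x : R) : 0 <= x -> x ^+ 2 <= 4 * expR x.
Proof.
move=> x0; have h : x / 2 <= expR (x / 2).
  by apply: le_trans (expR_ge1Dx _); lra.
have -> : expR x = expR (x / 2) ^+ 2.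
  by rewrite expr2 -expRD; congr expR; field.
have : (x / 2) ^+ 2 <= expR (x / 2) ^+ 2.
  by rewrite ler_pXn2r// nnegrE ?expR_ge0// divr_ge0.
by rewrite exprMn; lra.
Qed.

(** With r = 1/2 the exponential moment has exponent 3 x^2 / (8 s^2) and still
    dominates a multiple of x^4. *)
Lemma has_mean_pow4 s U : s != 0 -> centred_normal s U ->
  exists2 c, has_mean P (fun w => U w ^+ 4) c & c <= 512 * s ^+ 4.
Proof.
move=> s0 Us.
have s2 : 0 < s ^+ 2 by rewrite exprn_even_gt0.
have mU : measurable_fun setT (fun w => U w ^+ 4) by exact: measurable_funX.
have r0 : 0 < 2^-1 :> R by rewrite invr_gt0.
have H := has_meanZ (256 * s ^+ 4) (has_mean_exp_sqr s0 r0 Us).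
have dom w : `|U w ^+ 4| <= 256 * s ^+ 4 *
     expR (- ((2^-1 ^+ 2 - 1) / (2 * s ^+ 2) * U w ^+ 2)).
  have q0 k : 0 <= k -> 0 <= U w ^+ 2 / (k * s ^+ 2).
    by move=> k0; rewrite divr_ge0 ?sqr_ge0// pmulr_lge0.
  have h := sqr_le_expR (q0 8 (ler0n _ _)).
  rewrite ger0_norm ?exprn_even_ge0//.
  have -> : U w ^+ 4 = 64 * s ^+ 4 * (U w ^+ 2 / (8 * s ^+ 2)) ^+ 2 by field.
  have s4 : 0 < 64 * s ^+ 4 by rewrite pmulr_rgt0// exprn_even_gt0.
  have -> x : 256 * s ^+ 4 * x = 64 * s ^+ 4 * (4 * x) by ring.
  rewrite ler_pM2l//; apply: le_trans h _; rewrite ler_pM2l// ler_expR.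
  rewrite -subr_ge0.
  have -> : - ((2^-1 ^+ 2 - 1) / (2 * s ^+ 2) * U w ^+ 2) - U w ^+ 2 / (8 * s ^+ 2) =
    U w ^+ 2 / (4 * s ^+ 2) by field.
  exact: q0.
have [c Uc] := has_mean_dominated mU H dom.
exists c => //.
apply: (@le_trans _ _ (256 * s ^+ 4 * 2^-1^-1)); last by rewrite invrK; lra.
by apply: has_mean_le Uc H _ => w; apply: le_trans (ler_norm _) (dom w).
Qed.

Lemma has_mean_pow s U k : (k <= 4)%N -> s != 0 -> centred_normal s U ->
  exists c, has_mean P (fun w => U w ^+ k) c.
Proof.
move=> k4 s0 Us; have [c Uc _] := has_mean_pow4 s0 Us.
apply: (has_mean_dominated _ (has_meanD (has_mean_cst P 1) Uc)).
  exact: measurable_funX.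
move=> w; rewrite normrX -[X in 1 + X]ger0_norm ?exprn_even_ge0// normrX.
have [u1|/ltW u1] := leP `|U w| 1.
  by rewrite (le_trans (exprn_ile1 _ (normr_ge0 _) u1))// lerDl exprn_ge0.
by apply: (@le_trans _ _ (`|U w| ^+ 4)); [exact: ler_weXn2l|rewrite lerDr].
Qed.

(** The tangent inequality exp(a U) >= 1 + a U bounds 1 + a E[U] by
    exp(a^2 s^2 / 2) = 1 + O(a^2) for every [a] of either sign, which forces
    E[U] = 0. *)
Lemma has_mean_centred s U : s != 0 -> centred_normal s U -> has_mean P U 0.
Proof.
move=> s0 Us; have [m Um] := has_mean_pow (isT : (1 <= 4)%N) s0 Us.
have {}Um : has_mean P U m by apply: eq_has_mean Um => w; rewrite expr1.
have s2 : 0 < s ^+ 2 by rewrite exprn_even_gt0.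
have tangent a : 1 + a * m <= expR (a ^+ 2 * s ^+ 2 / 2).
  apply: (has_mean_le (has_meanD (has_mean_cst P 1) (has_meanZ a Um))
    (has_mean_exp a s0 Us)) => w; exact: expR_ge1Dx.
have expR_ub (u : R) : u < 1 -> expR u <= (1 - u)^-1.
  move=> u1; rewrite -[expR u]invrK lef_pV2 ?posrE ?invr_gt0 ?expR_gt0 ?subr_gt0//.
  by rewrite -expRN; have := expR_ge1Dx (- u); lra.
suff -> : 0 = m by [].
apply/eqP; rewrite eq_sym; apply: contraT => m0.
have m2 : 0 < m ^+ 2 by rewrite exprn_even_gt0.
(* At a = t m the left side exceeds 1 by q = t m^2 and the right side by about
   p q / 2 with p = t s^2; this [t] makes p + q = 1 / 2. *)
pose t := (2 * (s ^+ 2 + m ^+ 2))^-1.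
have t0 : 0 < t by rewrite invr_gt0 mulr_gt0// addr_gt0.
have tsm : t * s ^+ 2 + t * m ^+ 2 = 2^-1.
  by rewrite -mulrDr /t invfM mulfVK// gt_eqF// addr_gt0.
have p0 : 0 < t * s ^+ 2 by rewrite mulr_gt0.
have q0 : 0 < t * m ^+ 2 by rewrite mulr_gt0.
have := tangent (t * m).
have -> : 1 + t * m * m = 1 + t * m ^+ 2 by ring.
have -> : (t * m) ^+ 2 * s ^+ 2 / 2 = (t * s ^+ 2) * (t * m ^+ 2) / 2 by field.
move: (t * s ^+ 2) (t * m ^+ 2) tsm p0 q0 => p q pq p0 q0 h.
have pq1 : p * q < 1 / 4 by nra.
have := le_trans h (expR_ub (p * q / 2) ltac:(lra)).
rewrite -[leRHS]mul1r ler_pdivlMr; last by lra.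
by move=> {}h; nra.
Qed.

(** With v = E[U^2] / s^2, the tangent inequality 1 - u <= exp(- u) gives
    (r^2 - 1) v / 2 >= 1 - 1 / r for all r > 0, with equality at r = 1; hence the
    two sides have the same derivative there, which says v = 1. *)
Lemma has_mean_sqr s U : s != 0 -> centred_normal s U ->
  has_mean P (fun w => U w ^+ 2) (s ^+ 2).
Proof.
move=> s0 Us; have [m Um] := has_mean_pow (isT : (2 <= 4)%N) s0 Us.
have s2 : 0 < s ^+ 2 by rewrite exprn_even_gt0.
pose v := m / s ^+ 2.
have mE : m = v * s ^+ 2 by rewrite /v mulfVK// gt_eqF.
have tangent r : 0 < r -> 1 - r^-1 <= (r ^+ 2 - 1) / 2 * v.
  move=> r0.
  have H := has_meanD (has_mean_cst P 1) (has_meanZ (- ((r ^+ 2 - 1) / (2 * s ^+ 2))) Um).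
  have := has_mean_le H (has_mean_exp_sqr s0 r0 Us).
  have -> : 1 + - ((r ^+ 2 - 1) / (2 * s ^+ 2)) * m = 1 - (r ^+ 2 - 1) / 2 * v.
    by rewrite mE; field.
  move=> h; rewrite lerBlDr addrC -lerBlDr; apply: h => w.
  by rewrite mulNr; exact: expR_ge1Dx.
suff v1 : v = 1 by move: Um; rewrite mE v1 mul1r.
(* A crude lower bound for v makes 3 v - 1 positive below. *)
have v3 : 8 / 15 <= v by have := tangent (3 / 2) ltac:(lra); lra.
have v0 : 0 < v by lra.
(* This r lies on the side of 1 on which the tangent inequality fails, and turns
   it into (v - 1)^2 (3 v - 1) <= 0. *)
have := tangent ((v + 1) / (2 * v)) ltac:(by rewrite divr_gt0//; lra).
have -> : 1 - ((v + 1) / (2 * v))^-1 = (1 - v) / (1 + v).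
  by field; apply/andP; split; lra.
have -> : (((v + 1) / (2 * v)) ^+ 2 - 1) / 2 * v = (1 - v) * (3 * v + 1) / (8 * v).
  by field; lra.
rewrite ler_pdivrMr; last by lra.
rewrite mulrAC ler_pdivlMr; last by lra.
move=> h; apply/eqP; rewrite -subr_eq0 -sqrf_eq0 eq_le sqr_ge0 andbT.
rewrite -(@pmulr_rle0 _ (3 * v - 1)); last by lra.
by lra.
Qed.

End gaussian.

(** * Means of squares of sums *)

Section mean_bounds.
Context d (T : measurableType d) (R : realType) (P : probability T R).
Implicit Types f g : T -> R.

Definition mean_at_most f b := exists2 a, has_mean P f a & a <= b.

Lemma mean_at_most_sum (I : finType) (f : I -> T -> R) (b : I -> R) :
  (forall i, mean_at_most (f i) (b i)) ->
  mean_at_most (fun w => \sum_i f i w) (\sum_i b i).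
Proof.
move=> fb; have [a fa] := choice (fun i => let: ex_intro2 a p q := fb i in
  ex_intro (fun a => has_mean P (f i) a /\ a <= b i) a (conj p q)).
exists (\sum_i a i); first by apply: has_mean_sum => i; have [] := fa i.
by apply: ler_sum => i _; have [] := fa i.
Qed.

Lemma mean_at_mostZ c f b : 0 <= c -> mean_at_most f b ->
  mean_at_most (fun w => c * f w) (c * b).
Proof. by move=> c0 [a fa ab]; exists (c * a); [exact: has_meanZ|exact: ler_wpM2l]. Qed.

Lemma mean_at_most_le f g b : measurable_fun setT f ->
  (forall w, 0 <= f w <= g w) -> mean_at_most g b -> mean_at_most f b.
Proof.
move=> mf fg [a ga ab].
have [c fc] : exists c, has_mean P f c.
  apply: (has_mean_dominated mf ga) => w.
  by have /andP[f0 ?] := fg w; rewrite ger0_norm.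
exists c => //; apply: le_trans ab; apply: (has_mean_le fc ga) => w.
by have /andP[] := fg w.
Qed.

Lemma mean_at_most_weaken f b c : b <= c -> mean_at_most f b -> mean_at_most f c.
Proof. by move=> bc [a fa ab]; exists a => //; exact: le_trans bc. Qed.

(** Pythagoras: orthogonality of the summands kills the cross terms, so the mean
    of the square grows linearly with the number of summands. *)
Lemma has_mean_sqr_sum (I : finType) (f : I -> T -> R) (c : I -> R) :
  (forall i j, i != j -> has_mean P (fun w => f i w * f j w) 0) ->
  (forall i, has_mean P (fun w => f i w ^+ 2) (c i)) ->
  has_mean P (fun w => (\sum_i f i w) ^+ 2) (\sum_i c i).
Proof.
move=> cross sqr.
have H : has_mean P (fun w => \sum_i \sum_j f i w * f j w)
    (\sum_i \sum_j if j == i then c i else 0).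
  apply: has_mean_sum => i; apply: has_mean_sum => j.
  have [->|ji] := eqVneq j i; last by apply: cross; rewrite eq_sym.
  by apply: eq_has_mean (sqr i) => w; rewrite expr2.
rewrite (eq_bigr (fun i => \sum_j if j == i then c i else 0)); last first.
  by move=> i _; rewrite -big_mkcond big_pred1_eq.
by apply: eq_has_mean H => w; rewrite expr2 big_distrlr.
Qed.

Lemma mean_at_most_sqr_sum (I : finType) (f : I -> T -> R) (C : R) :
  (forall i j, i != j -> has_mean P (fun w => f i w * f j w) 0) ->
  (forall i, mean_at_most (fun w => f i w ^+ 2) C) ->
  mean_at_most (fun w => (\sum_i f i w) ^+ 2) (#|I|%:R * C).
Proof.
move=> cross sqr.
have [a fa] := choice (fun i => let: ex_intro2 a p q := sqr i in
  ex_intro (fun a => has_mean P (fun w => f i w ^+ 2) a /\ a <= C) a (conj p q)).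
exists (\sum_i a i); first by apply: has_mean_sqr_sum => // i; have [] := fa i.
rewrite mulr_natl -sumr_const; apply: ler_sum => i _.
by have [] := fa i.
Qed.

(** The hypotheses are on products of four entries only, hence the lemma applies
    to the rows of a matrix as well as to its columns. *)
Lemma mean_at_most_gram n q (xi : 'I_n -> 'I_q -> T -> R) (C : R) :
  let dev k l j w := xi k j w * xi l j w - (k == l)%:R in
  (forall k l i j, i != j -> has_mean P (fun w => dev k l i w * dev k l j w) 0) ->
  (forall k l i, mean_at_most (fun w => dev k l i w ^+ 2) C) ->
  mean_at_most (fun w =>
      frob2 (\matrix_(k, l) (\sum_j xi k j w * xi l j w) - q%:R%:M))
    (q%:R * (n ^ 2)%:R * C).
Proof.
move=> dev cross sqr.
have -> : (fun w => frob2 (\matrix_(k, l) (\sum_j xi k j w * xi l j w) - q%:R%:M)) =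
    (fun w => \sum_k \sum_l (\sum_j dev k l j w) ^+ 2).
  apply/funext => w; rewrite /frob2; apply: eq_bigr => k _; apply: eq_bigr => l _.
  by rewrite !mxE /dev sumrB sumr_const card_ord mulrnAC.
rewrite (_ : _ * C = \sum_(k < n) \sum_(l < n) q%:R * C); last first.
  by rewrite !sumr_const card_ord -mulrnA mulnn -[RHS]mulr_natl mulrCA mulrA.
apply: mean_at_most_sum => k; apply: mean_at_most_sum => l.
by have := mean_at_most_sqr_sum (cross k l) (sqr k l); rewrite card_ord.
Qed.

Lemma mean_at_most_normalized f q c : 0 <= c ->
  mean_at_most f (q%:R * c) -> mean_at_most (fun w => q%:R^-1 * f w) c.
Proof.
move=> c0 fqc.
apply: mean_at_most_weaken (mean_at_mostZ _ fqc); last by rewrite invr_ge0.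
have [->|q0] := eqVneq q 0%N; first by rewrite invr0 mul0r.
by rewrite mulKf// pnatr_eq0.
Qed.

End mean_bounds.

(** * Matrices with independent standard normal rows *)

Section normal_matrices.
Context d (T : measurableType d) (R : realType) (P : probability T R).

Lemma mutually_independent_pair (I : finType) (F : I -> set (set T)) i k A B :
  mutually_independent P F -> i != k -> F i A -> F k B ->
  P (A `&` B) = (P A * P B)%E.
Proof.
move=> FI ik FA FB.
have ki : k == i = false by apply/negbTE; rewrite eq_sym.
have := FI [set i; k]%SET (fun x => if x == i then A else B).
rewrite big_setU1 ?inE//= big_set1 eqxx ki => <-; last first.
  by move=> x; rewrite !inE => /orP[] /eqP ->; rewrite ?eqxx ?ki.
congr (P _); apply/seteqP; split => [w [wA wB] x /=|w H].
  by rewrite !inE => /orP[] /eqP ->; rewrite ?eqxx ?ki.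
have := H i; have := H k; rewrite /= !inE !eqxx ki orbT /=.
by move=> /(_ isT) ? /(_ isT) ?; split.
Qed.

(** The entries are measurable for the sigma-algebra generated by the matrix, and
    so are their products. *)
Lemma sigma_mx_prod m n (Y : 'M[{RV P >-> R}]_(m, n)) i j k l (B : set R) :
  measurable B -> sigma_mx Y ((fun w => Y i j w * Y k l w) @^-1` B).
Proof.
pose G := \bigcup_(ij : 'I_m * 'I_n) g_sigma_algebra_preimage (Y ij.1 ij.2).
have mY a b : measurable_fun setT (Y a b : g_sigma_algebraType G -> R).
  move=> _ A mA; apply: sub_sigma_algebra; exists (a, b) => //=.
  by exists A.
move=> mB.
have := measurable_funM (mY i j) (mY k l).
by move=> /(_ measurableT _ mB); rewrite setTI.
Qed.

Section one_matrix.
Variables (m n : nat) (X : 'M[{RV P >-> R}]_(m, n)).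
Hypothesis Xnormal : std_normal_rows X.

Lemma std_normal_entry i j : centred_normal P 1 (X i j).
Proof. by move=> B mB; have [/(_ j B mB) + _] := Xnormal.1 i; rewrite mxE. Qed.

Lemma std_normal_mean i j : has_mean P (X i j) 0.
Proof. exact: has_mean_centred (oner_neq0 _) (std_normal_entry i j). Qed.

Lemma std_normal_sqr i j : has_mean P (fun w => X i j w ^+ 2) 1.
Proof.
by have := has_mean_sqr (oner_neq0 _) (std_normal_entry i j); rewrite expr1n.
Qed.

Lemma independent_row_prod i i' j j' k k' : i != i' ->
  independent_fun P (fun w => X i j w * X i k w) (fun w => X i' j' w * X i' k' w).
Proof.
move=> ii A B mA mB; apply: (mutually_independent_pair Xnormal.2 ii).
- by have := @sigma_mx_prod _ _ (row i X) 0 j 0 k _ mA; rewrite !mxE.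
- by have := @sigma_mx_prod _ _ (row i' X) 0 j' 0 k' _ mB; rewrite !mxE.
Qed.

(** Entries of one row are independent by the law of the row, entries of different
    rows because the rows are. *)
Lemma independent_entries i i' j j' : (i, j) != (i', j') ->
  independent_fun P (X i j) (X i' j').
Proof.
have [<-{i'}|ii _] := eqVneq i i'.
  rewrite xpair_eqE eqxx /= => jj A B mA mB.
  apply: (mutually_independent_pair (Xnormal.1 i).2 jj).
  - by exists A => //; rewrite setTI mxE.
  - by exists B => //; rewrite setTI mxE.
move=> A B mA mB; apply: (mutually_independent_pair Xnormal.2 ii).
- by apply: sub_sigma_algebra; exists (0, j) => //=; exists A => //; rewrite setTI mxE.
- by apply: sub_sigma_algebra; exists (0, j') => //=; exists B => //; rewrite setTI mxE.
Qed.

Lemma has_mean_cross i i' j j' : (i, j) != (i', j') ->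
  has_mean P (fun w => X i j w * X i' j' w) 0.
Proof.
move=> ne; rewrite -[0](mul0r 0).
by apply: independent_meanM; [exact: independent_entries|exact: std_normal_mean..].
Qed.

(** The four corners of a rectangle: rows are independent and the two
    products along rows are centred. *)
Lemma has_mean_rectangle i i' j j' : i != i' -> j != j' ->
  has_mean P (fun w => X i j w * X i j' w * (X i' j w * X i' j' w)) 0.
Proof.
move=> ii jj; rewrite -[0](mul0r 0).
by apply: independent_meanM; [exact: independent_row_prod|
  apply: has_mean_cross; rewrite xpair_eqE negb_and jj orbT..].
Qed.

Lemma has_mean_sqr_centred i j : has_mean P (fun w => X i j w ^+ 2 - 1) 0.
Proof.
rewrite -(subrr 1).
by apply: has_meanD; [exact: std_normal_sqr|exact: has_mean_cst].
Qed.

Lemma has_mean_sqr_cross i i' j j' : (i, j) != (i', j') ->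
  has_mean P (fun w => (X i j w ^+ 2 - 1) * (X i' j' w ^+ 2 - 1)) 0.
Proof.
move=> ne; rewrite -[0](mul0r 0); apply: independent_meanM;
  [|exact: has_mean_sqr_centred..].
have mg : measurable_fun setT (fun x : R => x ^+ 2 - 1).
  by apply: measurable_funD => //; exact: measurable_funX.
exact: (independent_fun_comp mg mg (independent_entries ne)).
Qed.

Lemma has_mean_sqr_prod i i' j j' : (i, j) != (i', j') ->
  has_mean P (fun w => (X i j w * X i' j' w) ^+ 2) 1.
Proof.
move=> ne.
have H : has_mean P (fun w => X i j w ^+ 2 * X i' j' w ^+ 2) (1 * 1).
  apply: independent_meanM; [|exact: std_normal_sqr..].
  have mg : measurable_fun setT (fun x : R => x ^+ 2) by exact: measurable_funX.
  exact: (independent_fun_comp mg mg (independent_entries ne)).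
by rewrite -(mulr1 1); apply: eq_has_mean H => w; rewrite exprMn.
Qed.

Lemma mean_at_most_sqr_dev i j :
  mean_at_most P (fun w => (X i j w ^+ 2 - 1) ^+ 2) 512.
Proof.
have [c Xc] := has_mean_pow4 (oner_neq0 _) (std_normal_entry i j).
rewrite expr1n mulr1 => c512.
have H := has_meanD Xc
  (has_meanD (has_meanZ (-2) (std_normal_sqr i j)) (has_mean_cst P 1)).
exists (c + (-2 * 1 + 1)); last by lra.
by apply: eq_has_mean H => w; ring.
Qed.

(** The cross terms are products of two centred squares on the diagonal and
    rectangles off the diagonal, where the sides along [k], [l] are rows. *)
Lemma mean_at_most_row_gram :
  mean_at_most P (fun w => frob2 (eval_mx X w *m (eval_mx X w)^T - n%:R%:M))
    (n%:R * (m ^ 2)%:R * 512).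
Proof.
have -> : (fun w => frob2 (eval_mx X w *m (eval_mx X w)^T - n%:R%:M)) =
  (fun w => frob2 (\matrix_(k, l) (\sum_j X k j w * X l j w) - n%:R%:M)).
  apply/funext => w; congr (frob2 (_ - _)); apply/matrixP => k l.
  by rewrite !mxE; apply: eq_bigr => j _; rewrite !mxE.
apply: mean_at_most_gram => k l i.
- move=> j ij; have [<-{l}|kl] := eqVneq k l.
    apply: (eq_has_mean _ (@has_mean_sqr_cross k k i j _)) => [w|].
      by rewrite !expr2.
    by rewrite xpair_eqE negb_and ij orbT.
  apply: (eq_has_mean _ (has_mean_rectangle kl ij)) => w.
  by rewrite !subr0 mulrACA.
- have [<-{l}|kl] := eqVneq k l.
    by have [c hc c512] := mean_at_most_sqr_dev k i; exists c.
  exists 1; last by lra.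
  apply: (eq_has_mean _ (@has_mean_sqr_prod k l i i _)) => [w|].
    by rewrite subr0.
  by rewrite xpair_eqE negb_and kl.
Qed.

(** The same cross terms as for the rows, with the two directions of a rectangle
    exchanged. *)
Lemma mean_at_most_col_gram :
  mean_at_most P (fun w => frob2 ((eval_mx X w)^T *m eval_mx X w - m%:R%:M))
    (m%:R * (n ^ 2)%:R * 512).
Proof.
have -> : (fun w => frob2 ((eval_mx X w)^T *m eval_mx X w - m%:R%:M)) =
  (fun w => frob2 (\matrix_(k, l) (\sum_j X j k w * X j l w) - m%:R%:M)).
  apply/funext => w; congr (frob2 (_ - _)); apply/matrixP => k l.
  by rewrite !mxE; apply: eq_bigr => j _; rewrite !mxE.
apply: (@mean_at_most_gram _ _ _ _ _ _ (fun k j => X j k)) => k l i.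
- move=> j ij; have [<-{l}|kl] := eqVneq k l.
    apply: (eq_has_mean _ (@has_mean_sqr_cross i j k k _)) => [w|].
      by rewrite !expr2.
    by rewrite xpair_eqE negb_and ij.
  apply: (eq_has_mean _ (has_mean_rectangle ij kl)) => w.
  by rewrite !subr0.
- have [<-{l}|kl] := eqVneq k l.
    by have [c hc c512] := mean_at_most_sqr_dev i k; exists c.
  exists 1; last by lra.
  apply: (eq_has_mean _ (@has_mean_sqr_prod i i k l _)) => [w|].
    by rewrite subr0.
  by rewrite xpair_eqE negb_and kl orbT.
Qed.

Lemma has_mean_row_dot (b : 'cV[R]_n) i :
  has_mean P (fun w => (\sum_j X i j w * b j 0) ^+ 2) ||b||2.
Proof.
apply: has_mean_sqr_sum => [j k jk|j].
  have H := has_meanZ (b j 0 * b k 0) (@has_mean_cross i i j k _).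
  rewrite mulr0 in H; apply: (eq_has_mean _ (H _)) => [w|]; first ring.
  by rewrite xpair_eqE negb_and jk orbT.
have H := has_meanZ (b j 0 * b j 0) (std_normal_sqr i j).
by rewrite mulr1 in H; apply: eq_has_mean H => w; ring.
Qed.

(** Bounding the square of a sum by twice the sum of squares reduces the response to
    the separate laws of the design and of the noise. *)
Lemma mean_at_most_response (b : 'cV[R]_n) (e : 'cV[{RV P >-> R}]_m) (s : R) :
  s != 0 -> normal_vec s e^T ->
  mean_at_most P (fun w => ||eval_mx X w *m b + eval_mx e w||2)
    (m%:R * (2 * ||b||2 + 2 * s ^+ 2)).
Proof.
move=> s0 [elaw _].
have mX := @measurable_eval_mx _ _ _ P _ _ X.
have me := @measurable_eval_mx _ _ _ P _ _ e.
have my : measurable_mx (fun w => eval_mx X w *m b + eval_mx e w).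
  by apply: measurable_mxD => //; apply: measurable_mxM => //; exact: measurable_mx_cst.
apply: (@mean_at_most_le _ _ _ _ _
    (fun w => \sum_(i < m) (2 * (\sum_j X i j w * b j 0) ^+ 2 + 2 * e i 0 w ^+ 2))).
- by apply: measurable_sum => i; apply: measurable_funM; exact: my.
- move=> w; rewrite dotv_ge0 /=; apply: ler_sum => i _.
  have -> : (eval_mx X w *m b + eval_mx e w) i 0 = \sum_j X i j w * b j 0 + e i 0 w.
    by rewrite !mxE; congr (_ + _); apply: eq_bigr => j _; rewrite mxE.
  set u := \sum_j _; set v := e i 0 w; rewrite -subr_ge0.
  by rewrite (_ : _ - _ = (u - v) ^+ 2) ?sqr_ge0//; ring.
have -> : m%:R * (2 * ||b||2 + 2 * s ^+ 2) =
    \sum_(i < m) (2 * ||b||2 + 2 * s ^+ 2) by rewrite sumr_const card_ord mulr_natl.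
apply: mean_at_most_sum => i.
exists (2 * ||b||2 + 2 * s ^+ 2) => //.
apply: has_meanD; apply: has_meanZ; first exact: has_mean_row_dot.
by apply: has_mean_sqr => // B mB; rewrite -(elaw i B mB) mxE.
Qed.

End one_matrix.

End normal_matrices.

(** * Order in probability *)

Section stochastic_order.
Context d (T : measurableType d) (R : realType) (P : probability T R).

(** Markov's inequality makes the event that [F k] or [Y k] exceeds [M] have
    probability at most 2 K / M, uniformly in [k]; outside it the deterministic
    bound applies. *)
Lemma bigO_p_dominated (U : nat -> T -> R) (a : nat -> R) (F Y : nat -> T -> R) (K : R) :
  (forall k, measurable_fun setT (U k)) ->
  (forall k w, 0 <= F k w) -> (forall k w, 0 <= Y k w) ->
  (\forall k \near \oo, mean_at_most P (F k) K) ->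
  (\forall k \near \oo, mean_at_most P (Y k) K) ->
  (forall M, 0 < M -> exists2 L, 0 < L & \forall k \near \oo, forall w,
     F k w <= M -> Y k w <= M -> `|U k w| <= L * a k) ->
  bigO_p P U a.
Proof.
move=> mU F0 Y0 FK YK UL eps eps0.
(* Each of the two exceptional events gets probability at most eps / 4, so that
   the final inequality is strict. *)
pose M := (`|K| + 1) * 4 / eps.
have M0 : 0 < M by rewrite divr_gt0// mulr_gt0// ltr_wpDl.
have [L L0 HL] := UL M M0; exists L => //.
near=> k.
have [f Ff fK] : mean_at_most P (F k) K by near: k.
have [g Yg gK] : mean_at_most P (Y k) K by near: k.
have HLk : forall w, F k w <= M -> Y k w <= M -> `|U k w| <= L * a k by near: k.
have mF := measurable_gt_set M (has_mean_measurable Ff).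
have mY := measurable_gt_set M (has_mean_measurable Yg).
have tail (V : T -> R) v : has_mean P V v -> (forall w, 0 <= V w) -> v <= K ->
    (P [set w | (M < V w)%R] <= (eps / 4)%:E)%E.
  move=> Vv V0 vK; apply: (le_trans (has_mean_markov Vv V0 M0)).
  rewrite lee_fin ler_pdivrMr// (_ : eps / 4 * M = `|K| + 1); last first.
    by rewrite /M; field; rewrite gt_eqF.
  by apply: (le_trans vK); apply: (le_trans (ler_norm _)); rewrite lerDl.
apply: (@le_lt_trans _ _ (P ([set w | (M < F k w)%R] `|` [set w | (M < Y k w)%R]))).
  apply: le_measure; rewrite ?inE.
  - apply: measurable_gt_set; exact: (measurableT_comp (@normr_measurable _ _)).
  - exact: measurableU.
  - move=> w /= Uw; have [Fw|/HLk Fw] := ltP M (F k w); first by left.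
    by right; rewrite ltNge; apply/negP => /Fw; rewrite leNgt Uw.
apply: (le_lt_trans (measureU2 _ mF mY)).
apply: (le_lt_trans (leeD (tail _ _ Ff (F0 k) fK) (tail _ _ Yg (Y0 k) gK))).
by rewrite -EFinD lte_fin; lra.
Unshelve. all: by end_near.
Qed.

End stochastic_order.

Section growth.
Variable R : realType.

(** Any proportion strictly between the limit [delta] and 1 is eventually not
    exceeded; the midpoint is taken. *)
Lemma linear_remainder (s : nat -> nat) (delta : R) : delta < 1 ->
  (k%:R^-1 * (s k)%:R : R) @[k --> \oo] --> delta ->
  exists2 kappa : R, 0 < kappa & \forall k \near \oo,
    [/\ (0 < k)%N, (s k <= k)%N & kappa * k%:R <= (k - s k)%N%:R].
Proof.
move=> delta1 sd; exists ((1 - delta) / 2); first by lra.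
have lt1 : delta < (1 + delta) / 2 by lra.
have near_lt : \forall k \near \oo, (k%:R^-1 * (s k)%:R : R) < (1 + delta) / 2.
  exact: (cvgr_lt delta sd _ lt1).
near=> k.
have k0 : (0 < k)%N by near: k; exact: nbhs_infty_gt.
have kR : 0 < k%:R :> R by rewrite ltr0n.
have : (k%:R^-1 * (s k)%:R : R) < (1 + delta) / 2 by near: k.
rewrite -(ltr_pM2l kR) mulVKf ?gt_eqF// => sk.
have sk' : (s k <= k)%N by rewrite -(ler_nat R); nra.
by split=> //; rewrite natrB//; lra.
Unshelve. all: by end_near.
Qed.

Lemma near_linear_ge (kappa M : R) : 0 < kappa ->
  \forall k \near \oo, M <= kappa * k%:R.
Proof.
move=> kappa0; near=> k.
rewrite mulrC -ler_pdivrMr//; near: k; exact: nbhs_infty_ger.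
Unshelve. all: by end_near.
Qed.

Lemma l2norm_ge0 n (v : 'cV[R]_n) : 0 <= l2norm v.
Proof. exact: sqrtr_ge0. Qed.

Lemma l2norm_le n (v : 'cV[R]_n) c : 0 <= c -> ||v||2 <= c ^+ 2 -> l2norm v <= c.
Proof.
move=> c0 vc; rewrite l2normE -(ger0_norm c0) -sqrtr_sqr.
exact: ler_wsqrtr.
Qed.

End growth.

(** * The two limit statements *)

Theorem theorem3p4 (R : realType) (disp : measure_display)
    (T : measurableType disp) (P : probability T R)
    (sigma : R) (sigma_gt0 : 0 < sigma) :
  (forall (n0 : nat) (d0 : nat -> nat) (delta : R)
      (beta0 : forall d, 'cV[R]_(d0 d))
      (X : forall d, 'M[{RV P >-> R}]_(n0, d0 d))
      (e : forall d, 'cV[{RV P >-> R}]_n0)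
      (Z : forall d, 'M[{RV P >-> R}]_(n0, (d - d0 d)%N)),
    (exists B : R, forall d, l2norm (beta0 d) <= B) ->
    (forall d, std_normal_rows (X d)) ->
    (forall d, normal_vec sigma (e d)^T) ->
    (forall d, std_normal_rows (Z d)) ->
    (forall d, independent_mx (Z d) (row_mx (X d) (e d))) ->
    0 <= delta < 1 ->
    (d%:R^-1 * (d0 d)%:R : R) @[d --> \oo] --> delta ->
    let Xw d w := eval_mx (X d) w in
    let y d w := Xw d w *m beta0 d + eval_mx (e d) w in
    let beta_hat d w := min_norm_ols_aug (Xw d w) (eval_mx (Z d) w) (y d w) in
    bigO_p P
      (fun d w => l2norm (usubmx (beta_hat d w) -
                          ridge (d - d0 d)%:R (Xw d w) (y d w)))
      (fun d => d%:R^-1) /\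
    bigO_p P (fun d w => l2norm (dsubmx (beta_hat d w)))
      (fun d => (Num.sqrt d%:R)^-1))
  /\
  (forall (d0 : nat) (n0 : nat -> nat) (nu : R) (beta0 : 'cV[R]_d0)
      (X : forall n, 'M[{RV P >-> R}]_(n0 n, d0))
      (e : forall n, 'cV[{RV P >-> R}]_(n0 n))
      (W : forall n, 'M[{RV P >-> R}]_((n - n0 n)%N, d0)),
    (forall n, std_normal_rows (X n)) ->
    (forall n, normal_vec sigma (e n)^T) ->
    (forall n, std_normal_rows (W n)) ->
    (forall n, independent_mx (W n) (row_mx (X n) (e n))) ->
    0 <= nu < 1 ->
    (n%:R^-1 * (n0 n)%:R : R) @[n --> \oo] --> nu ->
    let Xw n w := eval_mx (X n) w in
    let y n w := Xw n w *m beta0 + eval_mx (e n) w in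
    bigO_p P
      (fun n w => l2norm (ols_aug (Xw n w) (eval_mx (W n) w) (y n w) -
                          ridge (n - n0 n)%:R (Xw n w) (y n w)))
      (fun n => (Num.sqrt n%:R)^-1)).
Proof.
have s0 : sigma != 0 by rewrite gt_eqF.
have scale_le (q : nat) (x M : R) : (0 < q)%N -> q%:R^-1 * x <= M -> x <= M * q%:R.
  by move=> q0; rewrite mulrC ler_pdivrMr ?ltr0n.
split.
- move=> n0 d0 delta beta0 X e Z [B betaB] Xn en Zn _ /andP[_ delta1] d0d Xw y bh.
  have mX d := measurable_eval_mx (X d).
  have mZ d := measurable_eval_mx (Z d).
  have me d := measurable_eval_mx (e d).
  have my d : measurable_mx (y d).
    by apply: measurable_mxD => //; apply: measurable_mxM => //; exact: measurable_mx_cst.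
  have mbh d : measurable_mx (bh d) by exact: measurable_min_norm_ols_aug.
  pose q d := (d - d0 d)%N.
  pose E d w := eval_mx (Z d) w *m (eval_mx (Z d) w)^T - (q d)%:R%:M.
  pose F d w := (q d)%:R^-1 * frob2 (E d w).
  pose K1 : R := (n0 ^ 2)%:R * 512.
  pose K2 : R := n0%:R * (2 * B ^+ 2 + 2 * sigma ^+ 2).
  have K10 : 0 <= K1 by rewrite mulr_ge0.
  have K20 : 0 <= K2.
    by rewrite mulr_ge0// addr_ge0// mulr_ge0// sqr_ge0.
  have FK : \forall d \near \oo, mean_at_most P (F d) (K1 + K2).
    near=> d; apply: (@mean_at_most_weaken _ _ _ _ _ K1); first by rewrite lerDl.
    by apply: mean_at_most_normalized => //; rewrite mulrA; exact: mean_at_most_row_gram.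
  have YK : \forall d \near \oo, mean_at_most P (fun w => ||y d w||2) (K1 + K2).
    near=> d; apply: (mean_at_most_weaken _ (mean_at_most_response (Xn d) _ s0 (en d))).
    apply: (@le_trans _ _ K2); last by rewrite lerDr.
    rewrite ler_wpM2l// lerD2r ler_pM2l//.
    have := betaB d; rewrite l2normE => bB.
    rewrite -[leLHS]sqr_sqrtr ?dotv_ge0// ler_pXn2r// nnegrE ?sqrtr_ge0//.
    exact: le_trans (sqrtr_ge0 _) bB.
  have [kappa kappa0 lin] := linear_remainder delta1 d0d.
  (* If F <= M then the squared deviation is at most M q, hence at most q^2 / 4
     once q >= 4 M, and the deterministic bounds apply. *)
  have good M : 0 < M -> \forall d \near \oo, forall w, F d w <= M -> ||y d w||2 <= M ->
      [/\ 0 < kappa * d%:R,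
       ||usubmx (bh d w) - ridge (q d)%:R (Xw d w) (y d w)||2 <=
         (M / (kappa * d%:R)) ^+ 2 &
       ||dsubmx (bh d w)||2 <= 2 * M / (kappa * d%:R)].
    move=> M0; near=> d => w Fw Yw.
    have [d_gt0 d0d' kq] : [/\ (0 < d)%N, (d0 d <= d)%N &
      kappa * d%:R <= (d - d0 d)%N%:R] by near: d.
    have M4 : 4 * M <= kappa * d%:R by near: d; exact: near_linear_ge.
    have kd0 : 0 < kappa * d%:R by rewrite mulr_gt0 ?ltr0n.
    rewrite -/(q d) in kq.
    have q0 : 0 < (q d)%:R :> R by lra.
    have EM : frob2 (E d w) <= M * (q d)%:R by apply: scale_le => //; rewrite -(ltr0n R).
    have Eq : frob2 (E d w) <= (q d)%:R ^+ 2 / 4.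
      apply: (le_trans EM); rewrite ler_pdivlMr// mulrAC expr2 ler_pM2r//; lra.
    have [dev1 dev2] := min_norm_ols_aug_dev (Xw d w) (y d w) q0 Eq.
    split=> //.
    - apply: (le_trans dev1).
      have -> : frob2 (E d w) * ||y d w||2 / (q d)%:R ^+ 3 =
          ((q d)%:R^-1 * frob2 (E d w)) * ||y d w||2 / (q d)%:R ^+ 2 by field; lra.
      rewrite exprMn exprVn [M ^+ 2]expr2; apply: ler_pM.
      + by rewrite mulr_ge0 ?dotv_ge0// mulr_ge0 ?invr_ge0 ?frob2_ge0.
      + by rewrite invr_ge0 sqr_ge0.
      + by apply: ler_pM => //; [rewrite mulr_ge0 ?invr_ge0 ?frob2_ge0|exact: dotv_ge0].
      + by rewrite lef_pV2 ?posrE ?exprn_gt0// ler_pXn2r// nnegrE ltW.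
    - apply: (le_trans dev2); apply: ler_pM => //.
      + by rewrite mulr_ge0// dotv_ge0.
      + by rewrite ler_pM2l.
      + by rewrite lef_pV2 ?posrE.
  split.
  + apply: (bigO_p_dominated (F := F) (Y := fun d w => ||y d w||2) _ _ _ FK YK).
    * move=> d; apply: measurable_l2norm; apply: measurable_mxB.
        exact: measurable_usubmx.
      exact: measurable_ridge.
    * by move=> d w; rewrite mulr_ge0 ?invr_ge0 ?frob2_ge0.
    * by move=> d w; exact: dotv_ge0.
    move=> M M0; exists (M / kappa); first exact: divr_gt0.
    apply: filterS (good M M0) => d gd w Fw Yw.
    have [kd0 H _] := gd w Fw Yw; rewrite ger0_norm ?l2norm_ge0// -mulrA -invfM.
    by apply: l2norm_le => //; rewrite divr_ge0// ltW.
  + apply: (bigO_p_dominated (F := F) (Y := fun d w => ||y d w||2) _ _ _ FK YK).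
    * by move=> d; apply: measurable_l2norm; exact: measurable_dsubmx.
    * by move=> d w; rewrite mulr_ge0 ?invr_ge0 ?frob2_ge0.
    * by move=> d w; exact: dotv_ge0.
    move=> M M0; exists (Num.sqrt (2 * M / kappa)).
      by rewrite sqrtr_gt0 divr_gt0// mulr_gt0.
    apply: filterS (good M M0) => d gd w Fw Yw.
    have [kd0 _ H] := gd w Fw Yw; rewrite ger0_norm ?l2norm_ge0//.
    apply: l2norm_le; first by rewrite mulr_ge0 ?invr_ge0 ?sqrtr_ge0.
    rewrite exprMn exprVn !sqr_sqrtr//; last by rewrite ltW// divr_gt0// mulr_gt0.
    by move: H; rewrite invfM mulrA.
- move=> d0 n0 nu beta0 X e W Xn en Wn _ /andP[_ nu1] n0n Xw y.
  have mX n := measurable_eval_mx (X n).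
  have mW n := measurable_eval_mx (W n).
  have me n := measurable_eval_mx (e n).
  have my n : measurable_mx (y n).
    by apply: measurable_mxD => //; apply: measurable_mxM => //; exact: measurable_mx_cst.
  pose q n := (n - n0 n)%N.
  pose E n w := (eval_mx (W n) w)^T *m eval_mx (W n) w - (q n)%:R%:M.
  pose F n w := (q n)%:R^-1 * frob2 (E n w).
  (* Here the number of rows grows, so |y|^2 is of order n and is normalised. *)
  pose Y n w := n%:R^-1 * ||y n w||2.
  pose K1 : R := (d0 ^ 2)%:R * 512.
  pose K2 : R := 2 * ||beta0||2 + 2 * sigma ^+ 2.
  have K10 : 0 <= K1 by rewrite mulr_ge0.
  have K20 : 0 <= K2 by rewrite addr_ge0// mulr_ge0// ?sqr_ge0// dotv_ge0.
  have [kappa kappa0 lin] := linear_remainder nu1 n0n.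
  have FK : \forall n \near \oo, mean_at_most P (F n) (K1 + K2).
    near=> n; apply: (@mean_at_most_weaken _ _ _ _ _ K1); first by rewrite lerDl.
    by apply: mean_at_most_normalized => //; rewrite mulrA; exact: mean_at_most_col_gram.
  have YK : \forall n \near \oo, mean_at_most P (Y n) (K1 + K2).
    near=> n; apply: (@mean_at_most_weaken _ _ _ _ _ K2); first by rewrite lerDr.
    have [_ n0n' _] : [/\ (0 < n)%N, (n0 n <= n)%N &
      kappa * n%:R <= (n - n0 n)%N%:R] by near: n.
    apply: mean_at_most_normalized => //.
    apply: (mean_at_most_weaken _ (mean_at_most_response (Xn n) _ s0 (en n))).
    by rewrite ler_wpM2r// ler_nat.
  apply: (bigO_p_dominated (F := F) (Y := Y) _ _ _ FK YK).
  + by move=> n; apply: measurable_l2norm; apply: measurable_mxB;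
      [exact: measurable_ols_aug|exact: measurable_ridge].
  + by move=> n w; rewrite mulr_ge0 ?invr_ge0 ?frob2_ge0.
  + by move=> n w; rewrite mulr_ge0 ?invr_ge0 ?dotv_ge0.
  move=> M M0; exists (2 * M / kappa); first by rewrite divr_gt0// mulr_gt0.
  near=> n => w Fw Yw.
  have [n_gt0 n0n' kq] : [/\ (0 < n)%N, (n0 n <= n)%N &
    kappa * n%:R <= (n - n0 n)%N%:R] by near: n.
  have M4 : 4 * M <= kappa * n%:R by near: n; exact: near_linear_ge.
  have nR : 0 < n%:R :> R by rewrite ltr0n.
  have kn0 : 0 < kappa * n%:R by rewrite mulr_gt0.
  rewrite -/(q n) in kq *.
  have qR : 0 < (q n)%:R :> R by lra.
  have EM : frob2 (E n w) <= M * (q n)%:R by apply: scale_le => //; rewrite -(ltr0n R).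
  have Eq : frob2 (E n w) <= (q n)%:R ^+ 2 / 4.
    by apply: (le_trans EM); rewrite ler_pdivlMr// mulrAC expr2 ler_pM2r//; lra.
  rewrite ger0_norm ?l2norm_ge0//.
  apply: l2norm_le.
    by rewrite mulr_ge0 ?invr_ge0 ?sqrtr_ge0// divr_ge0 ?mulr_ge0 ?ltW.
  apply: (le_trans (ols_aug_dev (Xw n w) (y n w) qR Eq)).
  have -> : 4 * frob2 (E n w) * ||y n w||2 / (q n)%:R ^+ 3 =
      4 * (F n w * Y n w) * n%:R / (q n)%:R ^+ 2.
    by rewrite /F /Y; field; rewrite !gt_eqF.
  rewrite exprMn exprVn sqr_sqrtr//.
  have -> : (2 * M / kappa) ^+ 2 / n%:R = 4 * (M * M) * n%:R / (kappa * n%:R) ^+ 2.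
    by field; rewrite !gt_eqF.
  have Y0 : 0 <= Y n w by rewrite mulr_ge0 ?invr_ge0 ?dotv_ge0.
  have F0 : 0 <= F n w by rewrite mulr_ge0 ?invr_ge0 ?frob2_ge0.
  apply: ler_pM.
  + by rewrite mulr_ge0// mulr_ge0// mulr_ge0.
  + by rewrite invr_ge0 sqr_ge0.
  + by rewrite ler_pM2r// ler_pM2l//; exact: ler_pM.
  + by rewrite lef_pV2 ?posrE ?exprn_gt0// ler_pXn2r// nnegrE ltW.
Unshelve. all: by end_near.
Qed.
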